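(* Let $(f_n)_{n=1,2,\ldots}$, $f_n:X^n\to Y$, be a family of functions that is computable with infinite memory. Then the family is frequency-based, i.e. there is a function $h:D\to Y$ such that for every $n$ and every $(x_1,\ldots,x_n)\in X^n$, $$f_n(x_1,\ldots,x_n)=h\big(p_0(x_1,\ldots,x_n),\,p_1(x_1,\ldots,x_n),\ldots,p_K(x_1,\ldots,x_n)\big).$$ The result remains true even if computability with infinite memory is only required over edge-labeled networks.
   Context: Frequencies. $X=\{0,1,\ldots,K\}$; $p_k(x_1,\ldots,x_n)=|\{i: x_i=k\}|/n$; $D=\{(p_0,\ldots,p_K)\in[0,1]^{K+1}:\sum_{k=0}^K p_k=1\}$ is the unit simplex. Model of computation. $X$ is the input set and $Y$ the output set. A network is a triple $(n,G,\mathcal L)$ where $n$ is the number of nodes, $G=(V,E)$ is a connected bidirectional graph with $n$ nodes (a directed graph such that $(i,j)\in E$ implies $(j,i)\in E$), $d(i)$ is the degree of node $i$ (its in-degree, equal to its out-degree), and $\mathcal L$ is a port labeling: it assigns to the outgoing edges of each node $i$ distinct integers (port numbers) from $\{0,1,\ldots,d(i)\}$. The network is edge-labeled if for every edge $(i,j)\in E$ the port number of $(i,j)$ at node $i$ equals the port number of $(j,i)$ at node $j$. An algorithm is a family of automata $(A_d)_{d=1,2,\ldots}$, where $A_d$ describes the behavior of a node of degree $d$. A state of $A_d$ is a tuple $[x,z,y;(m_1,\ldots,m_d)]$ with $x\in X$ (initial value), $z\in Z_d$ (internal memory state), $y\in Y$ (output), $m_1,\ldots,m_d\in M$ (outgoing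 messages). The sets $Y,Z_d,M$ are assumed to contain a special element $\emptyset$. $A_d$ is identified with a map from $X\times Z_d\times Y\times M^d$ to itself that does not change $x$. Execution: given initial values $x_1,\ldots,x_n\in X$, node $i$ runs $A_{d(i)}$ started at time $0$ with $x=x_i$ and $z=y=m_1=\cdots=m_{d(i)}=\emptyset$. At each node, the outgoing edges are enumerated according to their port numbers. Let $j_k$ be the node at the other end of the $k$th outgoing edge of $i$, and let $q_k$ be the position of the edge $(j_k,i)$ in the enumeration at $j_k$. For $t=0,1,2,\ldots$ all nodes simultaneously update $$[x_i,z_i(t+1),y_i(t+1);m_{i,1}(t+1),\ldots,m_{i,d(i)}(t+1)]=A_{d(i)}[x_i,z_i(t),y_i(t);m_{j_1,q_1}(t),\ldots,m_{j_{d(i)},q_{d(i)}}(t)].$$ The algorithm terminates with final output $y^*\in Y$ if there is a time $t'$ with $y_i(t)=y^*$ for all nodes $i$ and all $t\ge t'$. A family $(f_n)$, $f_n:X^n\to Y$, is computable with infinite memory if there is a family of automata $(A_d)_{d=1,2,\ldots}$ (not depending on $n$ or the network), with $M$ finite and with $Y$ and the $Z_d$ countably infinite, such that for every $n$, every network $(n,G,\mathcal L)$ and all initial values $x_1,\ldots,x_n\in X$ the algorithm terminates with final output $f_n(x_1,\ldots,x_n)$. It is computable with infinite memory over edge-labeled networks if this is required only for edge-labeled networks. *)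

(* Defs.v *)
From mathcomp Require Import all_boot all_order all_algebra.
From mathcomp Require Import reals.

Set Implicit Arguments.
Unset Strict Implicit.
Unset Printing Implicit Defensive.

Import Order.TTheory GRing.Theory Num.Theory.

Local Open Scope ring_scope.

Definition simplex (R : realType) (K : nat) : Type :=
  {p : {ffun 'I_K.+1 -> R} |
    [forall k, 0 <= p k <= 1] && (\sum_k p k == 1)}.

Definition freq_fun (R : realType) (K n : nat) (x : n.-tuple 'I_K.+1) :
    {ffun 'I_K.+1 -> R} :=
  [ffun k => #|[set i : 'I_n | tnth x i == k]|%:R / n%:R].

Lemma freq_subproof (R : realType) (K n : nat) (n_gt0 : (0 < n)%N)
    (x : n.-tuple 'I_K.+1) :
  [forall k, 0 <= freq_fun R x k <= 1] && (\sum_k freq_fun R x k == 1).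
Proof.
have nR : 0 < n%:R :> R by rewrite ltr0n.
apply/andP; split.
  apply/forallP => k; rewrite ffunE divr_ge0 ?ler0n //=.
  rewrite ler_pdivrMr // mul1r ler_nat.
  by rewrite (leq_trans (max_card _)) // card_ord.
under eq_bigr do rewrite ffunE.
rewrite -mulr_suml -natr_sum.
suff -> : (\sum_k #|[set i : 'I_n | tnth x i == k]|)%N = n.
  by rewrite divff // gt_eqF.
rewrite -[RHS]card_ord -sum1_card (partition_big (tnth x) predT) //=.
by apply: eq_bigr => k _; rewrite -sum1dep_card.
Qed.

Definition freq (R : realType) (K n : nat) (n_gt0 : (0 < n)%N)
    (x : n.-tuple 'I_K.+1) : simplex R K :=
  exist _ (freq_fun R x) (freq_subproof R n_gt0 x).

Definition frequency_based (R : realType) (K : nat) (Y : Type)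
    (f : forall n, n.-tuple 'I_K.+1 -> Y) : Prop :=
  exists h : simplex R K -> Y,
    forall (n : nat) (n_gt0 : (0 < n)%N) (x : n.-tuple 'I_K.+1),
      f n x = h (freq R n_gt0 x).

Local Open Scope nat_scope.

(* Edges are ordered pairs of nodes; as for any directed graph, (i, i) may be
   an edge, and it then counts once in the degree of i.  The value
   [port i j] is only meaningful when (i, j) is an edge. *)
Record network (n : nat) := Network {
  edge : rel 'I_n;
  edge_sym : symmetric edge;
  edge_connected : forall i j, connect edge i j;
  port : 'I_n -> 'I_n -> nat;
  port_bound : forall i j, edge i j -> port i j <= #|edge i|;
  port_inj : forall i j k,
    edge i j -> edge i k -> port i j = port i k -> j = k
}.

Definition degree (n : nat) (N : network n) (i : 'I_n) : nat := #|edge N i|.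

Definition edge_labeled (n : nat) (N : network n) : Prop :=
  forall i j, edge N i j -> port N i j = port N j i.

Definition neighbor_seq (n : nat) (N : network n) (i : 'I_n) : seq 'I_n :=
  sort (fun j k => port N i j <= port N i k) (enum (edge N i)).

Lemma size_neighbor_seq (n : nat) (N : network n) (i : 'I_n) :
  size (neighbor_seq N i) == degree N i.
Proof. by rewrite size_sort -cardE. Qed.

Definition neighbors (n : nat) (N : network n) (i : 'I_n) :
    (degree N i).-tuple 'I_n :=
  Tuple (size_neighbor_seq N i).

Definition position (n : nat) (N : network n) (j i : 'I_n) : nat :=
  index i (neighbors N j).

Record state (X Z Y M : Type) (d : nat) := State {
  st_init : X;
  st_mem : Z;
  st_out : Y;
  st_msg : d.-tuple M
}.

(* The automata are indexed by all d : nat, but the one for d = 0 is never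
   run, see [computable_over]. *)
Record algorithm (X Y : Type) := Algorithm {
  msg : finType;
  msg0 : msg;
  mem : nat -> Type;
  mem0 : forall d, mem d;
  automaton : forall d, state X (mem d) Y msg d -> state X (mem d) Y msg d;
  automaton_init : forall d (s : state X (mem d) Y msg d),
    st_init (automaton s) = st_init s
}.

Definition config (X Y : Type) (A : algorithm X Y) (n : nat) (N : network n) :
    Type :=
  forall i : 'I_n, state X (mem A (degree N i)) Y (msg A) (degree N i).

Definition init_config (X Y : Type) (y0 : Y) (A : algorithm X Y) (n : nat)
    (N : network n) (x : n.-tuple X) : config A N :=
  fun i => State (tnth x i) (mem0 A (degree N i)) y0
                 (nseq_tuple (degree N i) (msg0 A)).

(* The default value of [nth] is never reached: the neighbor j of i has i
   among its own neighbors, so [position N j i < degree N j]. *)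
Definition incoming (X Y : Type) (A : algorithm X Y) (n : nat) (N : network n)
    (c : config A N) (i : 'I_n) : (degree N i).-tuple (msg A) :=
  [tuple let j := tnth (neighbors N i) k in
         nth (msg0 A) (st_msg (c j)) (position N j i) | k < degree N i].

Definition step (X Y : Type) (A : algorithm X Y) (n : nat) (N : network n)
    (c : config A N) : config A N :=
  fun i => automaton (State (st_init (c i)) (st_mem (c i)) (st_out (c i))
                            (incoming c i)).

Definition execution (X Y : Type) (y0 : Y) (A : algorithm X Y) (n : nat)
    (N : network n) (x : n.-tuple X) (t : nat) : config A N :=
  iter t (@step X Y A n N) (init_config y0 A N x).

Definition terminates_with (X Y : Type) (y0 : Y) (A : algorithm X Y) (n : nat)
    (N : network n) (x : n.-tuple X) (y : Y) : Prop :=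
  exists t0 : nat, forall t, t0 <= t ->
    forall i, st_out (execution y0 A N x t i) = y.

Definition countably_infinite (T : Type) : Prop :=
  exists g : nat -> T, bijective g.

(* The condition on degrees says that the automata A_d, d >= 1, are applicable
   at every node; by connectedness it only discards the one-node network
   without edges. *)
Definition computable_over (P : forall n, network n -> Prop) (X Y : Type)
    (y0 : Y) (f : forall n, n.-tuple X -> Y) : Prop :=
  exists A : algorithm X Y,
    [/\ countably_infinite Y,
        forall d, 0 < d -> countably_infinite (mem A d)
      & forall (n : nat) (N : network n),
          0 < n -> (forall i, 0 < degree N i) -> P n N ->
          forall x : n.-tuple X, terminates_with y0 A N x (f n x)].

Definition computable_inf_mem (X Y : Type) (y0 : Y)
    (f : forall n, n.-tuple X -> Y) : Prop :=
  computable_over (fun _ _ => True) y0 f.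

Definition computable_inf_mem_edge_labeled (X Y : Type) (y0 : Y)
    (f : forall n, n.-tuple X -> Y) : Prop :=
  computable_over edge_labeled y0 f.

(* Main.v *)
Require Import Defs.
From mathcomp Require Import all_boot all_order all_algebra.
From mathcomp Require Import reals.
From mathcomp Require Import fingroup perm boolp zify.

(** A node only sees the messages of its neighbors, so it cannot distinguish a
    network from a covering of it.  If a map [p] from one network to another
    sends the neighbors of [i], listed by port, to the neighbors of [p i],
    listed by port, and if initial values are pulled back along [p], then at
    every time [i] and [p i] are in the same state
    ([covering_execution]).  Hence the two final outputs agree.

    The networks used here are Schreier graphs: a family of [d] involutions of
    the nodes, acting transitively and with distinct values at each node, gives
    a connected [d]-regular network in which port [a] of [i] leads to [s a i].
    Since [s a] is an involution, both ends of an edge give it the same port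
    number, so the network is edge-labeled; this is why a single argument covers
    both halves of the theorem.  A map that commutes with the involutions is a
    covering of Schreier graphs.  Moreover the involutions permute the fibers
    transitively, so that all fibers have the same size and pulling back initial
    values preserves frequencies.

    With [n >= 2], the two involutions of the path on [n] nodes that swap
    neighbors along the edges of either parity, and fix an end left unpaired,
    are such a family; the network is the path with a loop at each end.
    When [n] divides [L], folding a strip of [L] nodes onto [n] nodes commutes
    with these involutions, and thus [f x] is the value of [f] on a vector of
    length [L] that repeats [x] and its mirror image alternately
    ([repeat_fold]).  Relabeling the nodes of a path is also a covering, so [f]
    is invariant under permutations ([perm_invariant]).  Two vectors of lengths
    [n] and [m] with the same frequencies unfold to two vectors of length
    [m * n] with the same counts, hence equal up to a permutation, and [f] takes
    the same value on both.  A vector of length 1 is first doubled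
    ([double_singleton]), by covering the one-node loop by a single edge: on one
    node the two involutions of the path coincide. *)

Set Implicit Arguments.
Unset Strict Implicit.
Unset Printing Implicit Defensive.

Import GRing.Theory Num.Theory.

(** * Executions and coverings *)

Section Coverings.

Variables (X Y : Type) (y0 : Y) (A : algorithm X Y).

(** The type of a state depends on the degree of its node.  Packing the degree
    with the state lets states at nodes of different networks be compared. *)
Let node_state := {d : nat & state X (Defs.mem A d) Y (msg A) d}.

Definition local_state n (N : network n) (c : config A N) (i : 'I_n) :
    node_state :=
  Tagged (fun d => state X (Defs.mem A d) Y (msg A) d) (c i).

Definition receive (s : node_state) (u : (tag s).-tuple (msg A)) : node_state :=
  let v := tagged s in
  Tagged (fun d => state X (Defs.mem A d) Y (msg A) d)
    (automaton (State (st_init v) (st_mem v) (st_out v) u)).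

Lemma receive_eq (s s' : node_state) (u : (tag s).-tuple (msg A))
    (u' : (tag s').-tuple (msg A)) :
  s = s' -> u = u' :> seq (msg A) -> receive u = receive u'.
Proof. by move=> E; subst s' => /val_inj ->. Qed.

Lemma local_stateS n (N : network n) (x : n.-tuple X) t i :
  local_state (execution y0 A N x t.+1) i =
  receive (s := local_state (execution y0 A N x t) i)
    (incoming (execution y0 A N x t) i).
Proof. by []. Qed.

Lemma incomingE n (N : network n) (c : config A N) (i : 'I_n) :
  incoming c i =
  [seq nth (msg0 A) (st_msg (tagged (local_state c j))) (position N j i)
     | j <- neighbor_seq N i] :> seq (msg A).
Proof.
rewrite -[neighbor_seq N i in RHS]/(val (neighbors N i)).
by rewrite -[val (neighbors N i)]map_tnth_enum -map_comp.
Qed.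

(** Only neighbor lists are compared: ports enter an execution through the order
    of these lists alone, and the positions of reverse edges are then preserved
    automatically, see [covering_position]. *)
Definition covering n m (N : network n) (N' : network m)
    (p : 'I_n -> 'I_m) : Prop :=
  forall i, map p (neighbor_seq N i) = neighbor_seq N' (p i).

Variables (n m : nat) (N : network n) (N' : network m) (p : 'I_n -> 'I_m).
Hypothesis p_cov : covering N N' p.

Lemma covering_degree i : degree N i = degree N' (p i).
Proof.
by rewrite -!(eqP (size_neighbor_seq _ _)) -p_cov size_map.
Qed.

(** The neighbors of [p j] are listed without repetition, so [p] is injective on
    the neighbors of [j] and the index of [i] among them survives [p]. *)
Lemma covering_position i j : j \in neighbor_seq N i ->
  position N' (p j) (p i) = position N j i.
Proof.
rewrite /position /= -p_cov mem_sort mem_enum => ij.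
have uniq_p : uniq (map p (neighbor_seq N j)).
  by rewrite p_cov sort_uniq enum_uniq.
have i_j : i \in neighbor_seq N j.
  by rewrite mem_sort mem_enum -topredE /= edge_sym.
have lt_i : index i (neighbor_seq N j) < size (neighbor_seq N j).
  by rewrite index_mem.
rewrite -{1}(nth_index i i_j) -(nth_map _ (p i)) //.
by rewrite index_uniq // size_map.
Qed.

(** By induction on time: the states at time [t + 1] are computed by the same
    automaton from states and incoming messages that agree at time [t]. *)
Lemma covering_execution (x : n.-tuple X) (x' : m.-tuple X) t :
    (forall i, tnth x i = tnth x' (p i)) ->
  forall i, local_state (execution y0 A N x t) i =
            local_state (execution y0 A N' x' t) (p i).
Proof.
move=> xp; elim: t => [|t IHt] i.
  by rewrite /local_state /execution /= /init_config xp covering_degree.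
rewrite !local_stateS; apply: receive_eq => //.
rewrite !incomingE -p_cov -map_comp; apply/eq_in_map => j ij.
by rewrite [RHS]/comp -IHt (covering_position ij) IHt.
Qed.

Lemma covering_terminates (x : n.-tuple X) (x' : m.-tuple X) y y' :
    0 < n -> (forall i, tnth x i = tnth x' (p i)) ->
  terminates_with y0 A N x y -> terminates_with y0 A N' x' y' -> y = y'.
Proof.
move=> n_gt0 xp [t tP] [t' t'P]; pose i := Ordinal n_gt0.
rewrite -(tP (maxn t t') (leq_maxl _ _) i).
rewrite -(t'P (maxn t t') (leq_maxr _ _) (p i)).
by have /(congr1 (fun s : node_state => st_out (tagged s))) :=
  covering_execution (maxn t t') xp i.
Qed.

End Coverings.

(** * Networks generated by involutions *)

Section Schreier.

(** Transitivity is phrased as an induction principle, every invariant predicate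
    that holds somewhere holds everywhere, which is the form in which it is both
    used and transported along a bijection. *)
Definition spanning_involutions d n (s : 'I_d -> 'I_n -> 'I_n) : Prop :=
  [/\ forall a, involutive (s a), forall i, injective (s^~ i) &
      forall P : pred 'I_n, (forall a i, P i -> P (s a i)) ->
        forall i j, P i -> P j].

Variables (d n : nat) (s : 'I_d -> 'I_n -> 'I_n).
Hypothesis s_span : spanning_involutions s.

Definition schreier_edge : rel 'I_n := [rel i j | [exists a, s a i == j]].

(* The default value is reached only off the edges. *)
Definition schreier_port (i j : 'I_n) : nat :=
  if [pick a | s a i == j] is Some a then a else 0.

Lemma schreier_edgeP i j : reflect (exists a, j = s a i) (schreier_edge i j).
Proof. by apply: (iffP existsP) => -[a] => [/eqP <-|->]; exists a. Qed.

Lemma schreier_portE i a : schreier_port i (s a i) = a.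
Proof.
rewrite /schreier_port; case: pickP => [b /eqP|/(_ a)]; last by rewrite eqxx.
by case: s_span => _ s_inj _ /s_inj ->.
Qed.

Lemma schreier_edge_sym : symmetric schreier_edge.
Proof.
case: s_span => sK _ _ i j.
by apply/schreier_edgeP/schreier_edgeP => -[a ->]; exists a; rewrite sK.
Qed.

Lemma schreier_connected i j : connect schreier_edge i j.
Proof.
case: s_span => _ _ s_trans; apply: (s_trans _ _ i) (connect0 _ _) => a k ik.
by apply: connect_trans ik (connect1 _); apply/schreier_edgeP; exists a.
Qed.

Lemma enum_schreier_edge i :
  perm_eq (enum (schreier_edge i)) [seq s a i | a <- enum 'I_d].
Proof.
case: s_span => _ s_inj _.
apply: uniq_perm; rewrite ?enum_uniq ?(map_inj_uniq (s_inj i)) ?enum_uniq //.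
move=> j; rewrite mem_enum; apply/schreier_edgeP/mapP => -[a].
  by exists a; rewrite ?mem_enum.
by exists a.
Qed.

Lemma card_schreier_edge i : #|schreier_edge i| = d.
Proof.
by rewrite cardE (perm_size (enum_schreier_edge i)) size_map size_enum_ord.
Qed.

Lemma schreier_port_bound i j :
  schreier_edge i j -> schreier_port i j <= #|schreier_edge i|.
Proof.
by case/schreier_edgeP=> a ->; rewrite card_schreier_edge schreier_portE ltnW.
Qed.

Lemma schreier_port_inj i j k : schreier_edge i j -> schreier_edge i k ->
  schreier_port i j = schreier_port i k -> j = k.
Proof.
move=> /schreier_edgeP[a ->] /schreier_edgeP[b ->].
by rewrite !schreier_portE => /val_inj ->.
Qed.

Definition schreier : network n :=
  Network schreier_edge_sym schreier_connected
    schreier_port_bound schreier_port_inj.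

Lemma schreier_edge_labeled : edge_labeled schreier.
Proof.
move=> i j /schreier_edgeP[a ->] /=; rewrite schreier_portE.
by case: s_span => sK _ _; rewrite -{2}(sK a i) schreier_portE.
Qed.

Lemma neighbor_seq_schreier i :
  neighbor_seq schreier i = [seq s a i | a <- enum 'I_d].
Proof.
rewrite /neighbor_seq /=.
have mem_edge j : j \in enum (schreier_edge i) -> exists a, j = s a i.
  by rewrite mem_enum => /schreier_edgeP.
apply: (@sorted_eq_in _ (fun j k => schreier_port i j <= schreier_port i k)).
- by move=> j k l _ _ _; apply: leq_trans.
- move=> j k; rewrite !mem_sort => /mem_edge[a ->] /mem_edge[b ->].
  by rewrite !schreier_portE -eqn_leq => /eqP/val_inj ->.
- by apply: sort_sorted => j k; apply: leq_total.
- rewrite sorted_map; apply: (@sub_sorted _ (relpre val leq)).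
    by move=> a b /=; rewrite !schreier_portE.
  by rewrite -sorted_map val_enum_ord iota_sorted.
- by rewrite perm_sort enum_schreier_edge.
Qed.

End Schreier.

(** * Equivariant maps preserve frequencies *)

Definition count_value n (T : eqType) (x : n.-tuple T) (k : T) : nat :=
  #|[set i | tnth x i == k]|.

Lemma count_memE n (T : eqType) (x : n.-tuple T) (k : T) :
  count_mem k x = count_value x k.
Proof.
rewrite -{1}(map_tnth_enum x) count_map /count_value cardE -size_filter.
rewrite [enum [set _ | _]]/enum_mem -enumT; congr size.
by apply: eq_filter => i; rewrite /= [RHS]inE.
Qed.

Section Factors.

Variables (d n m : nat).
Variables (s : 'I_d -> 'I_n -> 'I_n) (r : 'I_d -> 'I_m -> 'I_m).
Hypotheses (s_span : spanning_involutions s) (r_span : spanning_involutions r).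
Variable p : 'I_n -> 'I_m.
Hypothesis p_equiv : forall a i, p (s a i) = r a (p i).

Lemma equivariant_covering : covering (schreier s_span) (schreier r_span) p.
Proof.
move=> i; rewrite !neighbor_seq_schreier -map_comp.
by apply: eq_map => a /=; rewrite p_equiv.
Qed.

(** Each involution maps a fiber injectively into another one, so by
    transitivity the size of a fiber is constant. *)
Lemma card_fiber (j : 'I_m) : #|[set i | p i == j]| * m = n.
Proof.
case: s_span r_span => sK _ _ [rK _ r_trans].
have fiber_le a k : #|[set i | p i == k]| <= #|[set i | p i == r a k]|.
  rewrite -(card_imset _ (inv_inj (sK a))); apply: subset_leq_card.
  apply/subsetP=> _ /imsetP[i + ->]; rewrite !inE p_equiv => /eqP ->.
  exact: eqxx.
have fiberE k : #|[set i | p i == k]| = #|[set i | p i == j]|.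
  apply/eqP; move: (eqxx #|[set i | p i == j]|).
  apply: (r_trans (fun k => #|[set i | p i == k]| == #|[set i | p i == j]|)).
  move=> a l /eqP <-; rewrite eqn_leq fiber_le andbT.
  by rewrite -{2}(rK a l) fiber_le.
rewrite -[RHS]card_ord -[RHS]sum1_card (partition_big p predT) //=.
rewrite (eq_bigr (fun=> #|[set i | p i == j]|)) => [|k _].
  by rewrite sum_nat_const card_ord mulnC.
by rewrite -(fiberE k) -sum1dep_card.
Qed.

Lemma equivariant_count (T : eqType) (x : m.-tuple T) (k : T) :
  count_value [tuple tnth x (p i) | i < n] k * m = count_value x k * n.
Proof.
rewrite /count_value -!sum1dep_card (partition_big p (fun j => tnth x j == k)).
  rewrite !big_distrl /=; apply: eq_bigr => j /eqP xj; rewrite mul1n.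
  rewrite -[RHS](card_fiber j) sum1dep_card; congr (_ * _).
  apply: eq_card => i; rewrite !inE tnth_mktuple andbC.
  by case: eqP => //= ->; rewrite xj eqxx.
by move=> i; rewrite tnth_mktuple.
Qed.

End Factors.

(** * Paths and foldings *)

(** The edge from [i] to [i.+1] belongs to the involution whose index has the
    parity of [i].  A move that would leave the path is a loop: at the right end
    this is the default value of [insubd], at the left end it is [0.-1 = 0]. *)
Definition path_move n (a : 'I_2) (i : 'I_n) : 'I_n :=
  insubd i (if odd i == odd a then i.+1 else i.-1).

Lemma val_path_move n a (i : 'I_n) : path_move a i =
  (if odd i == odd a then if i.+1 < n then i.+1 else i else i.-1) :> nat.
Proof.
rewrite val_insubd; case: (odd i == odd a) => //.
by rewrite (leq_ltn_trans (leq_pred i) (ltn_ord i)).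
Qed.

Lemma path_moveK n a : involutive (@path_move n a).
Proof.
move=> i; apply: val_inj => /=; rewrite 2!val_path_move; have := ltn_ord i.
do ![case: ifP]; lia.
Qed.

Lemma path_move_inj n (i : 'I_n) : 1 < n -> injective ((@path_move n)^~ i).
Proof.
move=> n_gt1 a b /(congr1 val) /=; rewrite !val_path_move => ab.
apply: val_inj => /=.
have := (ltn_ord i, ltn_ord a, ltn_ord b) => -[[lti lta] ltb].
move: ab; do ![case: ifP]; lia.
Qed.

Lemma path_move_transitive n (P : pred 'I_n) :
  (forall a i, P i -> P (path_move a i)) -> forall i j, P i -> P j.
Proof.
move=> P_move.
have P_succ (i j : 'I_n) : i.+1 = j :> nat -> P i = P j.
  move=> ij.
  have move_ij : path_move (inord (odd i)) i = j.
    apply: val_inj; rewrite /= val_path_move inordK ?ltnS ?leq_b1 //.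
    by rewrite oddb eqxx ij ltn_ord.
  by apply/idP/idP => /(P_move (inord (odd i))); rewrite -move_ij ?path_moveK.
suff P0 i : P i = P (Ordinal (leq_ltn_trans (leq0n i) (ltn_ord i))).
  by move=> i j; rewrite (P0 i) (P0 j); congr P; apply: val_inj.
case: i => k; elim: k => [|k IHk] lt_k.
  by congr P; apply: val_inj.
rewrite -(P_succ (Ordinal (ltnW lt_k))) // IHk; congr P; exact: val_inj.
Qed.

Lemma path_move_spanning n : 1 < n -> spanning_involutions (@path_move n).
Proof.
move=> n_gt1; split; first exact: path_moveK.
  by move=> i; apply: path_move_inj.
exact: path_move_transitive.
Qed.

(** Every other block of [n] consecutive integers is traversed backwards, so
    that adjacent integers have adjacent or equal images. *)
Definition fold_nat n i : nat := if odd (i %/ n) then n.-1 - i %% n else i %% n.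

Lemma fold_natE n q r : r < n ->
  fold_nat n (q * n + r) = if odd q then n.-1 - r else r.
Proof.
move=> lt_r; have n_gt0 : 0 < n by apply: leq_ltn_trans lt_r.
by rewrite /fold_nat divnMDl // divn_small // addn0 modnMDl modn_small.
Qed.

Lemma ltn_fold_nat n i : 0 < n -> fold_nat n i < n.
Proof.
move=> n_gt0; rewrite /fold_nat; case: ifP => _; last exact: ltn_pmod.
by rewrite (leq_ltn_trans (leq_subr _ _)) // ltn_predL.
Qed.

Definition fold n (n_gt0 : 0 < n) L (i : 'I_L) : 'I_n :=
  Ordinal (ltn_fold_nat i n_gt0).

(** Inside a block the fold preserves or reverses the direction of a move, and
    the parity of the position changes accordingly.  At a boundary between
    blocks, crossing it becomes the loop at an end of the short path.  The long
    path ends at block boundaries because [n] divides its length. *)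
Lemma fold_move n (n_gt0 : 0 < n) L a (i : 'I_L) :
  n %| L -> fold n_gt0 (path_move a i) = path_move a (fold n_gt0 i).
Proof.
case/dvdnP=> m L_eq; apply: val_inj; rewrite /= !val_path_move /=.
have lt_iL := ltn_ord i.
have [q [r [lt_r i_eq]]] : exists q r, r < n /\ val i = q * n + r.
  by exists (i %/ n), (i %% n); rewrite ltn_pmod // -divn_eq.
move: i_eq lt_iL => -> {i} lt_L.
have lt_q : q < m by rewrite -(ltn_pmul2r n_gt0); lia.
have le_qn : q.+1 * n <= L by rewrite L_eq leq_mul2r lt_q orbT.
(* A move [a] at [q * n + r] goes right iff the move [a] at its image goes
   right, up to the reversal of odd blocks. *)
have parity : (odd (if odd q then n.-1 - r else r) == odd a) =
    odd q (+) (odd (q * n + r) == odd a).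
  rewrite oddD oddM; case: (odd q) => //=.
  have -> : odd (n.-1 - r) = ~~ odd n (+) odd r.
    rewrite oddB; last by rewrite -ltnS prednK.
    by case: (n) n_gt0 => [|k] //=; rewrite negbK.
  by case: (odd n); case: (odd r); case: (odd a).
rewrite (fold_natE q lt_r) parity; case: (odd _ == odd a) => /= {parity}.
- have [r_n|r_n] := ltnP r.+1 n.
    have -> : (q * n + r).+1 < L by lia.
    rewrite -addnS fold_natE //; case: (odd q) => //=; rewrite ?r_n; lia.
  have r_eq : r = n.-1 by lia.
  have -> : (q * n + r).+1 = q.+1 * n + 0 by lia.
  have [_|_] := ltnP (q.+1 * n + 0) L; rewrite fold_natE //=.
    by case: (odd q) => /=; do ?[case: ifP]; lia.
  by case: (odd q) => /=; do ?[case: ifP]; lia.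
- have [r0|r_gt0] := posnP r.
    case: q lt_q le_qn lt_L => [|q] lt_q le_qn lt_L.
      by rewrite r0 -[(0 * n + 0).-1]/(0 * n + 0) fold_natE.
    have -> : (q.+1 * n + r).-1 = q * n + n.-1 by lia.
    rewrite fold_natE ?ltn_predL //=.
    by case: (odd q) => /=; do ?[case: ifP]; lia.
  have -> : (q * n + r).-1 = q * n + r.-1 by lia.
  rewrite fold_natE; last by lia.
  by case: (odd q) => /=; do ?[case: ifP]; lia.
Qed.

(** On one node the reversal is a loop, on two nodes it is an edge. *)
Lemma rev_ord_spanning n : 0 < n <= 2 ->
  spanning_involutions (fun _ : 'I_1 => @rev_ord n).
Proof.
move=> n_range; split=> [_|i a b _|P P_rev i j Pi]; first exact: rev_ordK.
  by rewrite !ord1.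
have [<- //|ij] := eqVneq i j.
suff -> : j = rev_ord i by apply: P_rev ord0 _ Pi.
apply: val_inj => /=; move: ij; rewrite -val_eqE /=.
have := (ltn_ord i, ltn_ord j) => -[] /=; lia.
Qed.

Lemma conjugate_spanning d n (s : 'I_d -> 'I_n -> 'I_n) (q : 'S_n) :
  spanning_involutions s ->
  spanning_involutions (fun a i => (q^-1)%g (s a (q i))).
Proof.
case=> sK s_inj s_trans; split.
- by move=> a i; rewrite permKV sK permK.
- by move=> i a b /perm_inj /s_inj.
- move=> P P_move i j Pi.
  rewrite -(permK q j); apply: (s_trans (fun k => P ((q^-1)%g k)) _ (q i)).
    by move=> a k Pk; rewrite -{1}(permKV q k); apply: P_move.
  by rewrite permK.
Qed.

(** * Functions computed by networks *)

Definition same_output_and_freq K (Y : Type)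
    (f : forall n, n.-tuple 'I_K.+1 -> Y)
    n m (x : n.-tuple 'I_K.+1) (x' : m.-tuple 'I_K.+1) : Prop :=
  f n x = f m x' /\
  forall k, count_value x k * m = count_value x' k * n.

Section Computable.

Variables (K : nat) (Y : Type) (y0 : Y).
Variable f : forall n, n.-tuple 'I_K.+1 -> Y.
Hypothesis f_computable : computable_inf_mem_edge_labeled y0 f.

Lemma equivariant_same d n m (s : 'I_d -> 'I_n -> 'I_n)
    (r : 'I_d -> 'I_m -> 'I_m) (p : 'I_n -> 'I_m) (x : m.-tuple 'I_K.+1) :
    0 < d -> 0 < n -> spanning_involutions s -> spanning_involutions r ->
    (forall a i, p (s a i) = r a (p i)) ->
  same_output_and_freq f x [tuple tnth x (p i) | i < n].
Proof.
move=> d_gt0 n_gt0 s_span r_span p_equiv; split; last first.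
  by move=> k; rewrite (equivariant_count s_span r_span p_equiv).
have m_gt0 : 0 < m by apply: leq_ltn_trans (ltn_ord (p (Ordinal n_gt0))).
case: f_computable => A [_ _ A_f].
have terminates k (t : 'I_d -> 'I_k -> 'I_k)
    (t_span : spanning_involutions t) z :
  0 < k -> terminates_with y0 A (schreier t_span) z (f z).
  move=> k_gt0.
  apply: (A_f k _ k_gt0 _ (@schreier_edge_labeled _ _ _ t_span) z) => i.
  by rewrite /degree /= card_schreier_edge.
apply/esym/(covering_terminates (equivariant_covering s_span r_span p_equiv)
  n_gt0 _ (terminates _ _ _ _ n_gt0) (terminates _ _ _ _ m_gt0)) => i.
by rewrite tnth_mktuple.
Qed.

Lemma double_singleton (x : 1.-tuple 'I_K.+1) :
  same_output_and_freq f x [tuple tnth x ord0 | _ < 2].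
Proof.
apply: (@equivariant_same 1 _ _ _ _ (fun=> ord0)) (rev_ord_spanning _)
  (rev_ord_spanning _) _ => // _ i.
exact: val_inj.
Qed.

(** The hypothesis [1 < n] makes the two moves differ at every node. *)
Lemma repeat_fold n (n_gt1 : 1 < n) L (x : n.-tuple 'I_K.+1) :
    0 < L -> n %| L ->
  same_output_and_freq f x [tuple tnth x (fold (ltnW n_gt1) i) | i < L].
Proof.
move=> L_gt0 n_L; have L_gt1 : 1 < L := leq_trans n_gt1 (dvdn_leq L_gt0 n_L).
apply: (equivariant_same _ _ _ (path_move_spanning L_gt1)
  (path_move_spanning n_gt1)) => // a i.
exact: fold_move.
Qed.

(** The permutation that relates the two vectors is a covering of the path by
    its own relabeling. *)
Lemma perm_invariant n (x x' : n.-tuple 'I_K.+1) :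
  1 < n -> (forall k, count_value x k = count_value x' k) -> f x = f x'.
Proof.
move=> n_gt1 eq_count.
have /tuple_permP[q x_eq] : perm_eq x x'.
  apply/allP => k _ /=; move: (eq_count k).
  by rewrite !count_memE => ->.
have n_gt0 := ltnW n_gt1.
have [-> _] := equivariant_same x' (p := q) (isT : 0 < 2) n_gt0
  (conjugate_spanning q (path_move_spanning n_gt1)) (path_move_spanning n_gt1)
  (fun a i => permKV q _).
by congr f; apply: val_inj; rewrite /= x_eq.
Qed.

(** Vectors with proportional counts are repeated to the common length [m * n],
    where their counts coincide. *)
Lemma same_freq_same_output n m (x : n.-tuple 'I_K.+1) (x' : m.-tuple 'I_K.+1) :
    0 < n -> 0 < m ->
    (forall k, count_value x k * m = count_value x' k * n) ->
  f x = f x'.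
Proof.
wlog n_gt1 : n x / 1 < n => [gen n_gt0 m_gt0 eq_freq|].
  case: n x n_gt0 eq_freq => [|[|n]] // x _ eq_freq; last exact: gen.
  have [-> same_freq] := double_singleton x; apply: gen => // k.
  by have := same_freq k; have := eq_freq k; lia.
wlog m_gt1 : m x' / 1 < m => [gen n_gt0 m_gt0 eq_freq|].
  case: m x' m_gt0 eq_freq => [|[|m]] // x' _ eq_freq; last exact: gen.
  have [-> same_freq] := double_singleton x'; apply: gen => // k.
  by have := same_freq k; have := eq_freq k; nia.
move=> n_gt0 m_gt0 eq_freq.
have L_gt0 : 0 < m * n by rewrite muln_gt0 m_gt0.
have [-> xL] := repeat_fold n_gt1 x L_gt0 (dvdn_mull m (dvdnn n)).
have [-> x'L] := repeat_fold m_gt1 x' L_gt0 (dvdn_mulr n (dvdnn m)).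
apply: perm_invariant => [|k]; first by nia.
move: (xL k) (x'L k) (eq_freq k); nia.
Qed.

Lemma computable_frequency_based (R : realType) : frequency_based R f.
Proof.
pose output_at (p : simplex R K) (y : Y) :=
  exists n (n_gt0 : 0 < n) (x : n.-tuple 'I_K.+1),
    freq R n_gt0 x = p /\ f x = y.
exists (fun p => if pselect (exists y, output_at p y) is left E
                 then projT1 (cid E) else y0) => n n_gt0 x.
case: pselect => [E|[]]; last by exists (f x), n, n_gt0, x.
case: (cid E) => /= y [m [m_gt0 [x' [eq_freq <-]]]].
apply: same_freq_same_output => // k.
move: eq_freq => /(congr1 sval) /ffunP /(_ k); rewrite !ffunE.
move/eqP; rewrite eqr_div ?pnatr_eq0 -?lt0n //.
by rewrite -!natrM eqr_nat => /eqP.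
Qed.

End Computable.

Theorem theorem3p1 (R : realType) (K : nat) (Y : Type) (y0 : Y)
    (f : forall n : nat, n.-tuple 'I_K.+1 -> Y) :
  (computable_inf_mem y0 f -> frequency_based R f) /\
  (computable_inf_mem_edge_labeled y0 f -> frequency_based R f).
Proof.
split=> f_computable; last exact: computable_frequency_based f_computable R.
have f_edge_labeled : computable_inf_mem_edge_labeled y0 f.
  case: f_computable => A [Y_countable mem_countable A_f].
  by exists A; split=> // n N n_gt0 deg_gt0 _; apply: A_f.
exact: computable_frequency_based f_edge_labeled R.
Qed.
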